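(* Assume that for some constants $0<a<b$, for all agents $i$, all $t\ge t_0$ and all $k\in\{1,\dots,K\}$, the iterates satisfy $aI_p\preceq\Gamma_{i,t}^k\preceq bI_p$, that $aI_p\preceq\Gamma^*\preceq bI_p$, and that a constant step size $\zeta_{i,t}^k=\zeta>0$ is used. Then after $W$ communication rounds and $K$ optimization iterations at time step $t\ge t_0$, $$\|\Gamma_{i,t}^K-\Gamma^*\|_F\le\beta^{K(t-t_0)}\|\Gamma_{i,t_0}^K-\Gamma^*\|_F+2\sum_{m=1}^K\beta^{K-m}\sum_{l=t_0+1}^t\beta^{K(t-l)}\|S_{i,l}^W-S^*\|_F,$$ where $\beta=\max\{|1-\zeta/a^2|,|1-\zeta/b^2|\}$.
   Context: Let $S^*\in\mathbb R^{p\times p}$ be positive definite and $X_1,X_2,\dots$ i.i.d. samples of $\mathcal N(0,S^* )$, $X_t=(x_{1t},\dots,x_{pt})^T$. There are $n$ agents, the vertices of a connected undirected unweighted graph $\mathcal G_a$; $N_i$ = neighbors of $i$, $\mathcal N_i=N_i\cup\{i\}$. Each agent directly measures some of the variables $x_1,\dots,x_p$; $x_j$ is observable by $i$ if measured by $i$ or a neighbor of $i$; $V_i$ is the diagonal $0/1$ matrix with $V_i(j,j)=1$ iff $x_j$ is observable by $i$. Communication protocol ($W$ rounds per time step): $S_{i,0}^W=0$; at time $t\ge1$, $\chi_{i,t}(j)=x_{jt}$ if $x_j$ observable by $i$, else $0$; with $\Sigma=\sum_{j\in\mathcal N_i}S_{j,t-1}^W$, $S_{i,t}^1=\frac1t((t-1)V_iS_{i,t-1}^WV_i+\chi_{i,t}\chi_{i,t}^T)+\frac1{|\mathcal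 N_i|}(\Sigma-V_i\Sigma V_i)$; for $2\le w\le W$, with $\Sigma_w=\sum_{j\in\mathcal N_i}S_{j,t}^{w-1}$, $S_{i,t}^w=V_iS_{i,t}^{w-1}V_i+\frac1{|\mathcal N_i|}(\Sigma_w-V_i\Sigma_wV_i)$. Optimization: given $\lambda>0$, $t_0,K\in\mathbb N$, and $\mathcal C_\lambda(x)=\min(\max(x,-\lambda),\lambda)$ entrywise: $\Gamma_{i,t_0}^K=S_{i,t_0}^W+\lambda I_p$; for $t>t_0$, $\Gamma_{i,t}^0=\Gamma_{i,t-1}^K$ and for $k=1,\dots,K$, $\Gamma_{i,t}^k=\mathcal C_\lambda(\Gamma_{i,t}^{k-1}-S_{i,t}^W+\zeta_{i,t}^{k-1}(\Gamma_{i,t}^{k-1})^{-1})+S_{i,t}^W$. Let $\Omega^*$ minimize $-\log\det\Omega+\mathrm{tr}(S^*\Omega)+\lambda\sum_{i,j}|\Omega(i,j)|$ over positive definite $\Omega$, and $\Gamma^*=(\Omega^* )^{-1}$. $\|\cdot\|_F$ is the Frobenius norm. *)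

(* Defs.v *)
From HB Require Import structures.
From mathcomp Require Import all_boot all_order all_algebra.
From mathcomp Require Import reals exp.
Set Implicit Arguments. Unset Strict Implicit. Unset Printing Implicit Defensive.
Import Order.TTheory GRing.Theory Num.Theory.
Local Open Scope ring_scope.

Section Defs.
Variable R : realType.

Definition symmx p (A : 'M[R]_p) : Prop := A^T = A.

Definition psd p (A : 'M[R]_p) : Prop :=
  symmx A /\ forall v : 'cV[R]_p, 0 <= (v^T *m A *m v) 0 0.

Definition posdef p (A : 'M[R]_p) : Prop :=
  symmx A /\ forall v : 'cV[R]_p, v != 0 -> 0 < (v^T *m A *m v) 0 0.

Definition loewner_le p (A B : 'M[R]_p) : Prop := psd (B - A).

Definition frob m n (A : 'M[R]_(m, n)) : R :=
  Num.sqrt (\sum_i \sum_j A i j ^+ 2).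

Definition clip m n (lam : R) (A : 'M[R]_(m, n)) : 'M[R]_(m, n) :=
  map_mx (fun x => Num.min (Num.max x (- lam)) lam) A.

Definition glasso_obj p (Sstar : 'M[R]_p) (lam : R) (Om : 'M[R]_p) : R :=
  - ln (\det Om) + \tr (Sstar *m Om) + lam * \sum_i \sum_j `|Om i j|.

Variables (p n : nat).
Variable e : rel 'I_n.                 (* adjacency of G_a *)
Variable meas : 'I_n -> 'I_p -> bool.  (* meas i j : agent i measures x_j *)
Variable X : nat -> 'cV[R]_p.          (* X t = X_t (t >= 1) *)

Definition nbh (i : 'I_n) : {set 'I_n} := [set k | (k == i) || e i k].

Definition observable (i : 'I_n) (j : 'I_p) : bool :=
  [exists k in nbh i, meas k j].

Definition Vmat (i : 'I_n) : 'M[R]_p :=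
  diag_mx (\row_j (if observable i j then 1 else 0)).

Definition chi (i : 'I_n) (t : nat) : 'cV[R]_p :=
  \col_j (if observable i j then X t j 0 else 0).

Definition nbsum (S : 'I_n -> 'M[R]_p) (i : 'I_n) : 'M[R]_p :=
  \sum_(k in nbh i) S k.

Definition mix (S : 'I_n -> 'M[R]_p) (i : 'I_n) : 'M[R]_p :=
  (#|nbh i|%:R)^-1 *: (nbsum S i - Vmat i *m nbsum S i *m Vmat i).

Definition round1 (t : nat) (prev : 'I_n -> 'M[R]_p) : 'I_n -> 'M[R]_p :=
  fun i => (t%:R)^-1 *: ((t.-1)%:R *: (Vmat i *m prev i *m Vmat i)
                          + chi i t *m (chi i t)^T) + mix prev i.

Definition roundw (cur : 'I_n -> 'M[R]_p) : 'I_n -> 'M[R]_p :=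
  fun i => Vmat i *m cur i *m Vmat i + mix cur i.

Fixpoint SW (W : nat) (t : nat) : 'I_n -> 'M[R]_p :=
  match t with
  | 0 => fun _ => 0
  | t'.+1 => iter W.-1 roundw (round1 t'.+1 (SW W t'))
  end.

Variables (W t0 K : nat) (lam zeta : R) (i : 'I_n).

Definition upd (t : nat) (G : 'M[R]_p) : 'M[R]_p :=
  clip lam (G - SW W t i + zeta *: invmx G) + SW W t i.

Definition Gbase : 'M[R]_p := SW W t0 i + lam%:M.

(* GK t = Gamma_{i,t}^K for t >= t0 *)
Fixpoint GK (t : nat) : 'M[R]_p :=
  match t with
  | 0 => Gbase
  | t'.+1 => if (t'.+1 <= t0)%N then Gbase else iter K (upd t'.+1) (GK t')
  end.

(* Gamma t k = Gamma_{i,t}^k for t > t0 (and Gamma_{i,t0}^K for t = t0) *)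
Definition Gamma (t k : nat) : 'M[R]_p :=
  if (t <= t0)%N then Gbase else iter k (upd t) (GK t.-1).

End Defs.

(* Main.v *)
Require Import Defs.
From HB Require Import structures.
From mathcomp Require Import all_boot all_order all_algebra.
From mathcomp Require Import reals exp.
From mathcomp Require Import ring lra.
Import Order.TTheory GRing.Theory Num.Theory.
Local Open Scope ring_scope.

(** Write [Y_k = Gamma_{i,t}^k]. The optimality conditions of the graphical
    lasso say that [Gamma* - S*] equals [lam] times a subgradient of the l1 norm
    at [Omega*], so [Gamma*] is a fixed point of
    [G |-> clip (G - S* + zeta G^-1) + S*]. Clipping is 1-Lipschitz, and
    [(G + zeta G^-1) - (H + zeta H^-1) = D - zeta G^-1 D H^-1] with [D = G - H].
    The operator [T : D |-> G^-1 D H^-1] is self-adjoint for the Frobenius inner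
    product with [b^-2 <= T <= a^-2], hence [1 - zeta T] contracts by [beta].
    One iteration thus gives
    [|Y_k - Gamma*| <= beta |Y_{k-1} - Gamma*| + 2 |S_{i,t} - S*|], and this
    recursion is unrolled over [k] and then over [t]. *)

(** * Discriminants and Cauchy-Schwarz for semidefinite forms *)

Lemma quadratic_ge0_discr {R : realFieldType} (a b c : R) : 0 <= a ->
  (forall x, 0 <= a * x ^+ 2 + 2 * b * x + c) -> b ^+ 2 <= a * c.
Proof.
rewrite le_eqVlt => /predU1P[<-|a_gt0] h.
  rewrite mul0r; have [->|b0] := eqVneq b 0; first by rewrite expr0n.
  (* For [a = 0] and [b != 0], the affine function takes the value -1 here. *)
  have := h (- (c + 1) / (2 * b)).
  have -> : 2 * b * (- (c + 1) / (2 * b)) = - (c + 1) by field.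
  by rewrite mul0r; lra.
have := h (- b / a).
have -> : a * (- b / a) ^+ 2 + 2 * b * (- b / a) + c = (a * c - b ^+ 2) / a.
  by field; lra.
by rewrite pmulr_lge0 ?invr_gt0// subr_ge0.
Qed.

(** Discriminant of [x |-> f (x *: u + v) (x *: u + v)]. The form may be degenerate, so this also
    serves for [mdot (T X) Y] with [T] merely nonnegative. *)
Lemma form_Cauchy_Schwarz {R : realFieldType} {V : lmodType R}
    (f : V -> V -> R) (u v : V) :
  (forall c x y z, f (c *: x + y) z = c * f x z + f y z) ->
  (forall x y, f x y = f y x) -> (forall x, 0 <= f x x) ->
  f u v ^+ 2 <= f u u * f v v.
Proof.
move=> fL fC f_ge0; apply: quadratic_ge0_discr => // x.
have := f_ge0 (x *: u + v).
rewrite fL (fC u) (fC v) !fL (fC v u); congr (0 <= _); ring.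
Qed.

(** * The Frobenius inner product and norm *)

Definition mdot {R : realType} {m n} (A B : 'M[R]_(m, n)) : R :=
  \sum_i \sum_j A i j * B i j.

Lemma mdotC {R : realType} {m n} (A B : 'M[R]_(m, n)) : mdot A B = mdot B A.
Proof. by apply: eq_bigr => i _; apply: eq_bigr => j _; rewrite mulrC. Qed.

Lemma mdot_linearl {R : realType} {m n} c (A B C : 'M[R]_(m, n)) :
  mdot (c *: A + B) C = c * mdot A C + mdot B C.
Proof.
rewrite mulr_sumr -big_split; apply: eq_bigr => i _ /=.
rewrite mulr_sumr -big_split; apply: eq_bigr => j _ /=.
by rewrite !mxE mulrDl mulrA.
Qed.

Lemma mdotDl {R : realType} {m n} (A B C : 'M[R]_(m, n)) :
  mdot (A + B) C = mdot A C + mdot B C.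
Proof. by rewrite -[A]scale1r mdot_linearl scale1r mul1r. Qed.

Lemma mdotZl {R : realType} {m n} c (A B : 'M[R]_(m, n)) :
  mdot (c *: A) B = c * mdot A B.
Proof.
by rewrite mulr_sumr; apply: eq_bigr => i _; rewrite mulr_sumr;
   apply: eq_bigr => j _; rewrite mxE mulrA.
Qed.

Lemma mdotDr {R : realType} {m n} (A B C : 'M[R]_(m, n)) :
  mdot A (B + C) = mdot A B + mdot A C.
Proof. by rewrite !(mdotC A) mdotDl. Qed.

Lemma mdotZr {R : realType} {m n} c (A B : 'M[R]_(m, n)) :
  mdot A (c *: B) = c * mdot A B.
Proof. by rewrite !(mdotC A) mdotZl. Qed.

Lemma mdot_tr {R : realType} {m n} (A B : 'M[R]_(m, n)) :
  mdot A B = \tr (A^T *m B).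
Proof.
rewrite /mdot exchange_big; apply: eq_bigr => j _; rewrite mxE.
by apply: eq_bigr => i _; rewrite mxE.
Qed.

Lemma mdot_ge0 {R : realType} {m n} (A : 'M[R]_(m, n)) : 0 <= mdot A A.
Proof. by do 2!apply: sumr_ge0 => ? _; rewrite -expr2 sqr_ge0. Qed.

Lemma mdot_gt0 {R : realType} {m n} (A : 'M[R]_(m, n)) : A != 0 -> 0 < mdot A A.
Proof.
move=> A0; rewrite lt_neqAle mdot_ge0 andbT eq_sym; apply: contraNneq A0 => AA0.
apply/eqP/matrixP => i j; rewrite mxE.
have ge0 k : 0 <= \sum_l A k l * A k l by apply: sumr_ge0 => l _; rewrite -expr2 sqr_ge0.
have Ai0 : \sum_l A i l * A i l = 0 by apply: (psumr_eq0P _ AA0).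
apply/eqP; rewrite -sqrf_eq0 expr2; apply/eqP.
by apply: (psumr_eq0P _ Ai0) => // l _; rewrite -expr2 sqr_ge0.
Qed.

Lemma mdot_Cauchy_Schwarz {R : realType} {m n} (A B : 'M[R]_(m, n)) :
  mdot A B ^+ 2 <= mdot A A * mdot B B.
Proof.
apply: form_Cauchy_Schwarz => [||?]; [exact: mdot_linearl|exact: mdotC|exact: mdot_ge0].
Qed.

Lemma frobE {R : realType} {m n} (A : 'M[R]_(m, n)) :
  frob A = Num.sqrt (mdot A A).
Proof. by []. Qed.

Lemma frob_ge0 {R : realType} {m n} (A : 'M[R]_(m, n)) : 0 <= frob A.
Proof. exact: sqrtr_ge0. Qed.

Lemma frob_sqr {R : realType} {m n} (A : 'M[R]_(m, n)) : frob A ^+ 2 = mdot A A.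
Proof. by rewrite frobE sqr_sqrtr ?mdot_ge0. Qed.

Lemma frobN {R : realType} {m n} (A : 'M[R]_(m, n)) : frob (- A) = frob A.
Proof. by rewrite !frobE -scaleN1r mdotZl mdotZr !mulN1r opprK. Qed.

Lemma ler_frobD {R : realType} {m n} (A B : 'M[R]_(m, n)) :
  frob (A + B) <= frob A + frob B.
Proof.
rewrite -ler_sqr ?nnegrE ?addr_ge0 ?frob_ge0//.
rewrite sqrrD !frob_sqr mdotDl !mdotDr (mdotC B A).
have : mdot A B <= frob A * frob B.
  apply: le_trans (ler_norm _) _.
  rewrite -ler_sqr ?nnegrE ?mulr_ge0 ?frob_ge0//.
  by rewrite real_normK ?num_real// exprMn !frob_sqr mdot_Cauchy_Schwarz.
rewrite mulr2n; lra.
Qed.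

(* Cauchy-Schwarz for the form <TX, Y>, applied to Y = TX. *)
Lemma selfadjoint_sqr_le {R : realType} {m n}
    (T : 'M[R]_(m, n) -> 'M[R]_(m, n)) (c : R) (A : 'M[R]_(m, n)) :
  0 <= c -> linear T -> (forall X Y, mdot (T X) Y = mdot X (T Y)) ->
  (forall X, 0 <= mdot (T X) X <= c * mdot X X) ->
  mdot (T A) (T A) <= c * mdot (T A) A.
Proof.
move=> c_ge0 TL Tadj Tb.
have : mdot (T A) (T A) ^+ 2 <= mdot (T A) A * mdot (T (T A)) (T A).
  apply: (@form_Cauchy_Schwarz _ _ (fun X Y => mdot (T X) Y)) => [d X Y Z|X Y|X].
  - by rewrite TL mdot_linearl.
  - by rewrite Tadj mdotC.
  - by case/andP: (Tb X).
have /andP[TA_ge0 _] := Tb A; have /andP[_ TTA_le] := Tb (T A).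
have := mdot_ge0 (T A); rewrite le_eqVlt => /predU1P[<- _|TTA_gt0].
  by rewrite mulr_ge0.
move=> h.
rewrite -(ler_pM2r TTA_gt0) -expr2; apply: le_trans h _.
by rewrite [leRHS]mulrAC mulrC ler_wpM2r.
Qed.

Lemma mdot_mulmxl {R : realType} {m n p} (A : 'M[R]_(m, p)) (X : 'M[R]_(p, n)) Y :
  mdot (A *m X) Y = mdot X (A^T *m Y).
Proof. by rewrite !mdot_tr trmx_mul mulmxA. Qed.

Lemma mdot_mulmxr {R : realType} {m n p} (X : 'M[R]_(m, p)) (B : 'M[R]_(p, n)) Y :
  mdot (X *m B) Y = mdot X (Y *m B^T).
Proof. by rewrite !mdot_tr trmx_mul -mulmxA mxtrace_mulC mulmxA. Qed.

Lemma mdot_trmx {R : realType} {m n} (A B : 'M[R]_(m, n)) :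
  mdot A^T B^T = mdot A B.
Proof. by rewrite !mdot_tr trmxK mxtrace_mulC -mxtrace_tr trmx_mul trmxK. Qed.

(** * Loewner bounds, Cholesky factors and determinants *)

Lemma qformE {R : realType} {p} (A : 'M[R]_p) (v : 'cV[R]_p) :
  (v^T *m A *m v) 0 0 = mdot v (A *m v).
Proof. by rewrite mdot_tr trace_mx11 mulmxA. Qed.

(** The pairing splits into the quadratic forms of the columns of [X]; Loewner bounds thus act on
    matrices as well as on vectors. *)
Lemma psd_mdot {R : realType} {p m} (A : 'M[R]_p) (X : 'M[R]_(p, m)) :
  psd A -> 0 <= mdot X (A *m X).
Proof.
move=> [_ A_ge0]; rewrite mdot_tr mulmxA; apply: sumr_ge0 => k _.
have := A_ge0 (col k X); congr (0 <= _).
rewrite tr_col -row_mul !mxE; apply: eq_bigr => l _; by rewrite !mxE.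
Qed.

Lemma loewner_mdot {R : realType} {p m} (A B : 'M[R]_p) (X : 'M[R]_(p, m)) :
  loewner_le A B -> mdot X (A *m X) <= mdot X (B *m X).
Proof.
move=> /(psd_mdot _ X).
by rewrite mulmxBl mdotDr -scaleN1r mdotZr mulN1r subr_ge0.
Qed.

Lemma loewner_lbound {R : realType} {p m} (c : R) (A : 'M[R]_p) (X : 'M[R]_(p, m)) :
  loewner_le c%:M A -> c * mdot X X <= mdot X (A *m X).
Proof. by move=> /(loewner_mdot _ _ X); rewrite mul_scalar_mx mdotZr. Qed.

Lemma loewner_ubound {R : realType} {p m} (c : R) (A : 'M[R]_p) (X : 'M[R]_(p, m)) :
  loewner_le A c%:M -> mdot X (A *m X) <= c * mdot X X.
Proof. by move=> /(loewner_mdot _ _ X); rewrite mul_scalar_mx mdotZr. Qed.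

Lemma loewner_lb_sym {R : realType} {p} (c : R) (A : 'M[R]_p) :
  loewner_le c%:M A -> A^T = A.
Proof.
by move=> [+ _]; rewrite /symmx linearB /= tr_scalar_mx => /(congr1 (+%R^~ c%:M)); rewrite !subrK.
Qed.

Lemma loewner_posdef {R : realType} {p} (c : R) (A : 'M[R]_p) :
  0 < c -> loewner_le c%:M A -> posdef A.
Proof.
move=> c0 cA; split; first exact: loewner_lb_sym cA.
move=> v v0; rewrite qformE; apply: lt_le_trans (loewner_lbound _ _ _ cA).
by rewrite mulr_gt0 ?mdot_gt0.
Qed.

Lemma posdef_unitmx {R : realType} {p} (A : 'M[R]_p) : posdef A -> A \in unitmx.
Proof.
move=> [sA A_gt0]; rewrite unitmxE unitfE; apply/det0P => -[v v0 vA0].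
have := A_gt0 v^T; rewrite trmxK vA0 mul0mx mxE ltxx.
by rewrite -(inj_eq trmx_inj) trmxK trmx0 => /(_ v0).
Qed.

(** Induction on the size: split off the pivot [al] and factor its Schur complement [S]. *)
Lemma posdef_cholesky {R : realType} {p} (A : 'M[R]_p) :
  posdef A -> exists L : 'M[R]_p, A = L *m L^T.
Proof.
elim: p A => [A _|n IH]; first by exists 0; rewrite [A]flatmx0 [RHS]flatmx0.
rewrite -[n.+1]/(1 + n)%N => A [sA A_gt0].
set al := ulsubmx A 0 0; set r := dlsubmx A; set D := drsubmx A.
have defA : A = block_mx al%:M r^T r D.
  by rewrite -[LHS]submxK [ulsubmx A]mx11_scalar /r trmx_dlsub sA.
have al_gt0 : 0 < al.
  have := A_gt0 (col_mx 1 0).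
  rewrite {1}defA tr_col_mx trmx0 mul_row_block !mul0mx !addr0 mul_row_col mulmx0 addr0.
  rewrite trmx1 mul1mx mulmx1 mxE eqxx mulr1n; apply.
  apply/eqP => /(congr1 usubmx); rewrite col_mxKu => /matrixP/(_ 0 0).
  by rewrite !mxE => /eqP; rewrite oner_eq0.
pose S := D - al^-1 *: (r *m r^T).
have [|L defS] := IH S.
  split.
    rewrite /symmx linearB linearZ /= trmx_mul trmxK; congr (_ - _).
    by rewrite /D trmx_drsub sA.
  (* The upper block of [w] is chosen so that the upper block of [A *m w] vanishes; the form of [A]
     at [w] is then that of [S] at [v]. *)
  move=> v v0; pose w := col_mx (- al^-1 *: (r^T *m v)) v.
  have w0 : w != 0.
    by apply: contraNneq v0 => /(congr1 dsubmx); rewrite col_mxKd => ->; rewrite linear0.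
  have := A_gt0 w w0; rewrite -!mulmxA {1}defA mul_block_col.
  have -> : al%:M *m (- al^-1 *: (r^T *m v)) + r^T *m v = 0.
    by rewrite mul_scalar_mx scalerA mulrN divff ?gt_eqF// scaleN1r addNr.
  have -> : r *m (- al^-1 *: (r^T *m v)) + D *m v = S *m v.
    by rewrite /S mulmxBl -scalemxAr scaleNr addrC -scalemxAl mulmxA.
  by rewrite tr_col_mx mul_row_col mulmx0 add0r.
exists (block_mx (Num.sqrt al)%:M 0 ((Num.sqrt al)^-1 *: r) L).
have s0 : Num.sqrt al != 0 by rewrite sqrtr_eq0 -ltNge.
rewrite tr_block_mx mulmx_block !trmx0 !mul0mx !mulmx0 !addr0 tr_scalar_mx.
rewrite -scalar_mxM -expr2 sqr_sqrtr ?ltW//.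
rewrite mul_scalar_mx linearZ /= scalerA divff// scale1r.
rewrite mul_mx_scalar scalerA divff// scale1r -defS.
rewrite -scalemxAl -scalemxAr scalerA -invfM -expr2 sqr_sqrtr ?ltW//.
by rewrite /S addrC subrK.
Qed.

(** The determinant is the square of [\det L], and it is nonzero by invertibility. *)
Lemma posdef_det_gt0 {R : realType} {p} (A : 'M[R]_p) : posdef A -> 0 < \det A.
Proof.
move=> pA; have := posdef_unitmx _ pA; rewrite unitmxE unitfE lt_neqAle eq_sym => ->.
have [L ->] := posdef_cholesky _ pA.
by rewrite det_mulmx det_tr -expr2 sqr_ge0.
Qed.

Lemma loewner_of_mdot {R : realType} {p} (A B : 'M[R]_p) :
  A^T = A -> B^T = B ->
  (forall v : 'cV_p, mdot v (A *m v) <= mdot v (B *m v)) -> loewner_le A B.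
Proof.
move=> sA sB h; split; first by rewrite /symmx linearB /= sA sB.
move=> v; rewrite qformE mulmxBl mdotDr -scaleN1r mdotZr mulN1r subr_ge0; exact: h.
Qed.

(** * Spectral bounds for inverses and for [D |-> A D B] *)

(** With [w = G^-1 v], the inequality [|G w|^2 <= b <G w, w>] reads [|v|^2 <= b <v, G^-1 v>]. *)
Lemma loewner_invmx_lb {R : realType} {p} (a b : R) (G : 'M[R]_p) :
  0 < a -> 0 < b -> loewner_le a%:M G -> loewner_le G b%:M ->
  loewner_le (b^-1)%:M (invmx G).
Proof.
move=> a0 b0 aG Gb; have sG := loewner_lb_sym _ _ aG.
have uG := posdef_unitmx _ (loewner_posdef _ _ a0 aG).
apply: loewner_of_mdot; rewrite ?tr_scalar_mx ?trmx_inv ?sG// => v.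
rewrite mul_scalar_mx mdotZr mulrC ler_pdivrMr//.
have := selfadjoint_sqr_le (mulmx G) b (invmx G *m v).
rewrite mulKVmx// (mulrC b); apply; first exact: ltW.
- by move=> c X Y; rewrite mulmxDr scalemxAr.
- by move=> X Y; rewrite mdot_mulmxl sG.
- move=> X; rewrite mdotC; rewrite loewner_ubound// andbT.
  by apply: le_trans (loewner_lbound _ _ _ aG); rewrite mulr_ge0 ?mdot_ge0 ?ltW.
Qed.

(** With [w = G^-1 v] and [x = <v, w>], one has [a |w|^2 <= x] and [x^2 <= |v|^2 |w|^2]; hence
    [a x^2 <= |v|^2 x], and [x] cancels. *)
Lemma loewner_invmx_ub {R : realType} {p} (a : R) (G : 'M[R]_p) :
  0 < a -> loewner_le a%:M G -> loewner_le (invmx G) (a^-1)%:M.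
Proof.
move=> a0 aG; have sG := loewner_lb_sym _ _ aG.
have uG := posdef_unitmx _ (loewner_posdef _ _ a0 aG).
apply: loewner_of_mdot; rewrite ?tr_scalar_mx ?trmx_inv ?sG// => v.
rewrite mul_scalar_mx mdotZr mulrC ler_pdivlMr//.
set w := invmx G *m v.
have := loewner_lbound a G w aG; rewrite mulKVmx// => aw.
have := mdot_Cauchy_Schwarz v w; rewrite (mdotC w v) in aw *.
set x := mdot v w in aw *; have v0 := mdot_ge0 v; have w0 := mdot_ge0 w => h.
have : 0 <= x by apply: le_trans aw; rewrite mulr_ge0 // ltW.
rewrite le_eqVlt => /predU1P[<-|x0]; first by rewrite mul0r.
rewrite -(ler_pM2r x0).
have -> : x * a * x = a * x ^+ 2 by ring.
apply: le_trans (_ : a * (mdot v v * mdot w w) <= _); first by rewrite ler_pM2l.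
have -> : a * (mdot v v * mdot w w) = mdot v v * (a * mdot w w) by ring.
by rewrite ler_wpM2l.
Qed.

(** Writing [B = L L^T] turns the pairing into [<DL, A (DL)>], which is comparable to
    [|DL|^2 = <D^T, B D^T>]. Each of [A] and [B] contributes one factor [mu] or [M]. *)
Lemma sandwich_bounds {R : realType} {p} (mu M : R) (A B D : 'M[R]_p) :
  0 < mu -> 0 < M ->
  loewner_le mu%:M A -> loewner_le A M%:M -> loewner_le mu%:M B -> loewner_le B M%:M ->
  mu ^+ 2 * mdot D D <= mdot D (A *m D *m B) <= M ^+ 2 * mdot D D.
Proof.
move=> mu0 M0 muA AM muB BM.
have [L defB] := posdef_cholesky _ (loewner_posdef _ _ mu0 muB).
have -> : mdot D (A *m D *m B) = mdot (D *m L) (A *m (D *m L)).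
  by rewrite mdot_mulmxr defB !mulmxA.
have DL : mdot (D *m L) (D *m L) = mdot D^T (B *m D^T).
  rewrite mdot_mulmxr -mulmxA -defB -[in RHS](trmxK B) -trmx_mul mdot_trmx.
  by rewrite (loewner_lb_sym _ _ muB).
have lo := loewner_lbound _ _ D^T muB; have up := loewner_ubound _ _ D^T BM.
rewrite mdot_trmx in lo up.
apply/andP; split.
  apply: le_trans (loewner_lbound _ _ _ muA).
  by rewrite expr2 -mulrA ler_pM2l// DL.
apply: le_trans (loewner_ubound _ _ _ AM) _.
by rewrite expr2 -mulrA ler_pM2l// DL.
Qed.

(** The spectrum of [T] lies in [[mu^2, M^2]]. Instead of diagonalizing, the proof applies
    [selfadjoint_sqr_le] to [T - mu^2], which bounds [|TD|^2] by an affine function of [<D, TD>]. *)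
Lemma sandwich_contraction {R : realType} {p} (mu M zeta beta : R) (A B D : 'M[R]_p) :
  0 < mu -> mu <= M ->
  loewner_le mu%:M A -> loewner_le A M%:M -> loewner_le mu%:M B -> loewner_le B M%:M ->
  `|1 - zeta * mu ^+ 2| <= beta -> `|1 - zeta * M ^+ 2| <= beta ->
  frob (D - zeta *: (A *m D *m B)) <= beta * frob D.
Proof.
move=> mu0 muM muA AM muB BM b1 b2.
have M0 : 0 < M by exact: lt_le_trans muM.
have beta0 : 0 <= beta by apply: le_trans b1; rewrite normr_ge0.
have sA := loewner_lb_sym _ _ muA; have sB := loewner_lb_sym _ _ muB.
have bd X := sandwich_bounds _ _ _ _ X mu0 M0 muA AM muB BM.
pose T X := A *m X *m B.
have muM2 : mu ^+ 2 <= M ^+ 2 by rewrite ler_sqr ?nnegrE ?(ltW mu0) ?(ltW M0).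
have TT X Y : mdot (T X) Y = mdot X (T Y).
  by rewrite /T mdot_mulmxr mdot_mulmxl sA sB mulmxA.
have key : mdot (T D - mu ^+ 2 *: D) (T D - mu ^+ 2 *: D) <=
    (M ^+ 2 - mu ^+ 2) * mdot (T D - mu ^+ 2 *: D) D.
  apply: (selfadjoint_sqr_le (fun X => T X - mu ^+ 2 *: X)).
  - by rewrite subr_ge0.
  - move=> c X Y; rewrite /T mulmxDr mulmxDl -scalemxAr -scalemxAl.
    by rewrite !scalerDr scalerN !scalerA (mulrC c) opprD addrACA.
  - by move=> X Y; rewrite !mdotDl !mdotDr TT -!scaleNr mdotZl mdotZr.
  - move=> X; rewrite mdotDl -scaleNr mdotZl TT; have /andP[] := bd X; rewrite -/(T X).
    by move=> h1 h2; apply/andP; split; lra.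
rewrite -ler_sqr ?nnegrE ?mulr_ge0 ?frob_ge0// exprMn !frob_sqr.
have /andP[] := bd D; rewrite -/(T D) => lo up.
move: key; rewrite -!scaleNr !mdotDl !mdotDr !mdotZl !mdotZr (mdotC (T D) D).
set x := mdot D (T D) in lo up *; set y := mdot (T D) (T D); set d := mdot D D in lo up *.
set m1 := mu ^+ 2 in b1 lo muM2 *; set m2 := M ^+ 2 in b2 up muM2 *.
have sq c : `|1 - zeta * c| <= beta -> (1 - zeta * c) ^+ 2 * d <= beta ^+ 2 * d.
  move=> h; rewrite ler_wpM2r ?mdot_ge0// -[leLHS]real_normK ?num_real//.
  by rewrite ler_sqr ?nnegrE.
have {sq b1 b2} [b1 b2] := (sq _ b1, sq _ b2) => key.
(* Expanded, [key] says [<(T - m1)(T - m2) D, D> <= 0]. *)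
have zy : zeta ^+ 2 * y <= zeta ^+ 2 * ((m1 + m2) * x - m1 * m2 * d).
  by rewrite ler_wpM2l ?sqr_ge0//; lra.
(* the resulting bound is affine in x, hence maximal at an endpoint of [m1 d, m2 d] *)
have [s0|s0] := lerP 0 (zeta ^+ 2 * (m1 + m2) - 2 * zeta).
  have := ler_wpM2l s0 up; lra.
have := ler_wnM2l (ltW s0) lo; lra.
Qed.

(** * First-order variation of the objective *)

Lemma le_of_small {R : realFieldType} (x y c d : R) : 0 < d -> 0 <= c ->
  (forall h, 0 < h -> h < d -> x <= y + c * h) -> x <= y.
Proof.
move=> d0 c0 hx; rewrite leNgt; apply/negP => yx.
(* The second bound gives [2 (c + 1) h <= x - y], which contradicts [x - y <= c h]. *)
pose h := Num.min (d / 2) ((x - y) / (2 * (c + 1))).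
have h0 : 0 < h by rewrite lt_min !divr_gt0 ?subr_gt0 ?mulr_gt0 ?ltr_wpDl.
have hd : h < d by rewrite gt_min; apply/orP; left; lra.
have := hx h h0 hd.
have : h * (2 * (c + 1)) <= x - y.
  by rewrite -ler_pdivlMr ?mulr_gt0 ?ltr_wpDl// ge_min lexx orbT.
have : 0 <= c * h by rewrite mulr_ge0// ltW.
nra.
Qed.

(* det (1 + h M) is h^p times the characteristic polynomial of -M at 1/h. *)
Lemma det_1addZ_expansion {R : realFieldType} {p} (M : 'M[R]_p) :
  exists2 C, 0 <= C & forall h, 0 < h -> h <= 1 ->
    `|\det (1%:M + h *: M) - 1 - h * \tr M| <= C * h ^+ 2.
Proof.
case: p M => [|q] M.
  by exists 0 => // h _ _; rewrite det_mx00 /mxtrace big_ord0 mulr0 !subrr normr0 mul0r.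
pose chi := char_poly (- M).
exists (\sum_(k < q) `|chi`_k|); first by apply: sumr_ge0.
move=> h h0 h1.
have -> : \det (1%:M + h *: M) = h ^+ q.+1 * chi.[h^-1].
  rewrite -[chi.[_]]/(horner_eval h^-1 chi) /chi /char_poly -det_map_mx -detZ.
  congr (\det _); apply/matrixP => i j; rewrite !mxE /= /horner_eval.
  rewrite hornerD hornerN hornerC hornerMn hornerX mulrBr mulrN opprK.
  by rewrite mulrnAr divff // (gt_eqF h0).
rewrite horner_coef size_char_poly !big_ord_recr /=.
have -> : chi`_q = \tr M by rewrite (char_poly_trace (- M) (ltn0Sn q)) raddfN opprK.
have -> : chi`_q.+1 = 1.
  by have /monicP := char_poly_monic (- M); rewrite lead_coefE size_char_poly.
rewrite mul1r !mulrDr -exprMn divff ?gt_eqF// expr1n.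
have -> : h ^+ q.+1 * (\tr M * h^-1 ^+ q) = h * \tr M.
  by rewrite mulrCA exprS -mulrA -exprMn divff ?gt_eqF// expr1n mulr1 mulrC.
have -> (x y : R) : x + y + 1 - 1 - y = x by ring.
rewrite mulr_sumr mulr_suml; apply: le_trans (ler_norm_sum _ _ _) _.
apply: ler_sum => k _; rewrite mulrCA normrM ler_wpM2l//.
have kq : (k < q.+1)%N by exact: leqW (ltn_ord k).
(* Since [k < q], the exponent [q.+1 - k] is at least 2, so for [h <= 1] the power is at most
   [h ^+ 2]. *)
rewrite exprVn -expfB// normrX gtr0_norm//; apply: ler_wiXn2l; rewrite ?(ltW h0)//.
by rewrite ltn_subRL addn1 ltnS ltn_ord.
Qed.

(** Cauchy-Schwarz for [<v, E v> = <v v^T, E>], where [|v v^T| = |v|^2]. *)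
Lemma qform_lbound {R : realType} {p} (E : 'M[R]_p) (v : 'cV[R]_p) :
  - (frob E * mdot v v) <= mdot v (E *m v).
Proof.
have -> : mdot v (E *m v) = mdot (v *m v^T) E by rewrite mdot_mulmxr trmxK.
have vv : mdot (v *m v^T) (v *m v^T) = mdot v v ^+ 2.
  rewrite mdot_mulmxr trmxK -mulmxA [v^T *m v]mx11_scalar mul_mx_scalar mdotZr expr2.
  by rewrite -trace_mx11 -mdot_tr.
have := mdot_Cauchy_Schwarz (v *m v^T) E.
rewrite vv -(frob_sqr E) -exprMn mulrC -[leLHS]real_normK ?num_real//.
rewrite ler_sqr ?nnegrE ?mulr_ge0 ?frob_ge0 ?mdot_ge0//.
by rewrite ler_norml => /andP[].
Qed.

(** Keeps small symmetric perturbations of [Om] among the competitors of the minimization. *)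
Lemma posdef_perturb {R : realType} {p} (mu h : R) (A E : 'M[R]_p) :
  E^T = E -> loewner_le mu%:M A -> 0 < h -> h * frob E < mu -> posdef (A + h *: E).
Proof.
move=> sE muA h0 hE; split.
  by rewrite /symmx linearD linearZ /= sE (loewner_lb_sym _ _ muA).
move=> v v0; rewrite qformE mulmxDl mdotDr -scalemxAl mdotZr.
have := loewner_lbound _ _ v muA; have := ler_wpM2l (ltW h0) (qform_lbound E v).
have := mdot_gt0 _ v0; set d := mdot v v => d0.
have : 0 < (mu - h * frob E) * d by rewrite mulr_gt0// subr_gt0.
lra.
Qed.

Lemma ln_ge_1subV {R : realType} (x : R) : 0 < x -> 1 - x^-1 <= ln x.
Proof.
move=> x0; have xV : 0 < x^-1 by rewrite invr_gt0.
have : ln (1 + (x^-1 - 1)) <= x^-1 - 1 by apply: le_ln1Dx; lra.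
by rewrite addrC subrK lnV ?posrE//; lra.
Qed.

(** One-sided stationarity along [E]: [- ln det] has derivative [- <Om^-1, E>], and [c] bounds the
    growth rate of the l1 norm. Compare the objective at [Om + h E] and [Om], divide by [h], and let
    [h] tend to 0. *)
Lemma glasso_stationary {R : realType} {p} (S Om E : 'M[R]_p) (lam mu c d : R) :
  S^T = S -> E^T = E -> 0 < mu -> 0 < lam -> loewner_le mu%:M Om ->
  (forall Om', posdef Om' -> glasso_obj S lam Om <= glasso_obj S lam Om') ->
  0 < d ->
  (forall h, 0 < h -> h < d ->
     \sum_i \sum_j `|(Om + h *: E) i j| <= \sum_i \sum_j `|Om i j| + c * h) ->
  mdot (invmx Om) E <= mdot S E + lam * c.
Proof.
move=> sS sE mu0 lam0 muOm Ommin d0 hc.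
have pOm := loewner_posdef _ _ mu0 muOm.
have sOm := loewner_lb_sym _ _ muOm; have uOm := posdef_unitmx _ pOm.
have [C C0 hC] := det_1addZ_expansion (invmx Om *m E).
have -> : mdot (invmx Om) E = \tr (invmx Om *m E) by rewrite mdot_tr trmx_inv sOm.
set tau := \tr _ in hC *; set k := _ + _.
(* Collects the second-order errors: [C] from the determinant expansion, the rest from replacing
   [k * P] by [k]. *)
pose B := C + `|k| * (`|tau| + C).
(* The three bounds serve the l1 estimate, the determinant expansion and positive definiteness of
   [Om + h E]. *)
pose d' := Num.min (Num.min d 1) (mu / (frob E + 1)).
have B0 : 0 <= B by rewrite addr_ge0// mulr_ge0// addr_ge0.
have fE0 : 0 < frob E + 1 by rewrite ltr_wpDl ?frob_ge0.
apply: (@le_of_small _ _ _ B d') => //.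
  by rewrite !lt_min d0 ltr01 divr_gt0.
move=> h h0; rewrite !lt_min => /andP[/andP[hd h1]].
rewrite ltr_pdivlMr// => hmu.
have pOmh : posdef (Om + h *: E).
  by apply: (posdef_perturb mu) => //; apply: le_lt_trans hmu; rewrite mulrDr mulr1; lra.
pose P := \det (1%:M + h *: (invmx Om *m E)).
have detE : \det (Om + h *: E) = \det Om * P.
  by rewrite -det_mulmx mulmxDr mulmx1 -scalemxAr mulmxA mulmxV// mul1mx.
have dOm := posdef_det_gt0 _ pOm.
have P0 : 0 < P by have := posdef_det_gt0 _ pOmh; rewrite detE pmulr_rgt0.
have := Ommin _ pOmh; rewrite /glasso_obj detE lnM ?posrE//.
have trS X : \tr (S *m X) = mdot S X by rewrite mdot_tr sS.
rewrite !trS mdotDr mdotZr.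
have := ler_wpM2l (ltW lam0) (hc h h0 hd); rewrite mulrDr => l1 obj.
have lnP : ln P <= h * k by rewrite /k; lra.
(* From [1 - P^-1 <= ln P]. As [P - 1] is [h * tau] up to second order, this compares [tau] with
   [k]. *)
have PkP : P - 1 <= h * k * P.
  have := le_trans (ln_ge_1subV _ P0) lnP.
  by rewrite -(ler_pM2r P0) mulrBl mul1r mulVf ?gt_eqF.
have := hC h h0 (ltW h1); rewrite -/P ler_norml => /andP[Plo Pup].
have Pk : k * P <= k + `|k| * (`|tau| + C) * h.
  have -> : k * P = k + k * (P - 1) by ring.
  rewrite lerD2l; apply: le_trans (ler_norm _) _; rewrite normrM -mulrA ler_wpM2l//.
  have -> : P - 1 = (P - 1 - h * tau) + h * tau by ring.
  apply: le_trans (ler_normD _ _) _; rewrite normrM (gtr0_norm h0).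
  have : `|P - 1 - h * tau| <= C * h ^+ 2 by rewrite ler_norml Plo.
  have : C * h ^+ 2 <= C * h by rewrite ler_wpM2l// expr2 ger_pMl// ltW.
  lra.
rewrite -(ler_pM2l h0).
have : h * (k * P) <= h * (k + `|k| * (`|tau| + C) * h) by rewrite ler_pM2l.
rewrite /B; lra.
Qed.

(** * Entrywise optimality conditions of the graphical lasso *)

Lemma mdot_delta {R : realType} {m n} (A : 'M[R]_(m, n)) i j :
  mdot A (delta_mx i j) = A i j.
Proof.
rewrite /mdot (bigD1 i)//= (bigD1 j)//= mxE !eqxx mulr1.
rewrite !big1 ?addr0// => [k ki|l lj].
  by rewrite big1// => l _; rewrite mxE (negPf ki) mulr0.
by rewrite mxE eqxx (negPf lj) mulr0.
Qed.

(** For [i = j] this is twice the matrix unit, so pairing with a symmetric [A] gives [2 * A i j] in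
    every case. *)
Definition symdelta {R : realType} {p} (i j : 'I_p) : 'M[R]_p :=
  delta_mx i j + delta_mx j i.

Lemma symdelta_sym {R : realType} {p} (i j : 'I_p) :
  (symdelta i j : 'M[R]_p)^T = symdelta i j.
Proof. by rewrite /symdelta linearD /= !trmx_delta addrC. Qed.

Lemma symdelta_ge0 {R : realType} {p} (i j k l : 'I_p) :
  0 <= (symdelta i j : 'M[R]_p) k l.
Proof. by rewrite !mxE addr_ge0. Qed.

Lemma symdelta_le2 {R : realType} {p} (i j k l : 'I_p) :
  (symdelta i j : 'M[R]_p) k l <= 2.
Proof. by rewrite !mxE; do 2!case: (_ && _) => /=; lra. Qed.

Lemma symdelta_supp {R : realType} {p} (A : 'M[R]_p) (i j k l : 'I_p) :
  A^T = A -> (symdelta i j : 'M[R]_p) k l = 0 \/ A k l = A i j.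
Proof.
move=> sA; rewrite !mxE; have [/andP[/eqP-> /eqP->]|_] := boolP (_ && _); first by right.
have [/andP[/eqP-> /eqP->]|_] := boolP (_ && _); last by left; rewrite addr0.
by right; rewrite -{1}sA mxE.
Qed.

Lemma mdot_symdelta {R : realType} {p} (A : 'M[R]_p) (i j : 'I_p) :
  A^T = A -> mdot A (symdelta i j) = 2 * A i j.
Proof. by move=> sA; rewrite mdotDr !mdot_delta -{2}sA mxE; ring. Qed.

(** Stationarity along [eps *: symdelta i j]: [eps] is the direction of the move, [sg] the rate at
    which absolute values of entries may grow. *)
Lemma glasso_entry {R : realType} {p} (S Om : 'M[R]_p) (lam mu d eps sg : R)
    (i j : 'I_p) :
  S^T = S -> 0 < mu -> 0 < lam -> loewner_le mu%:M Om ->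
  (forall Om', posdef Om' -> glasso_obj S lam Om <= glasso_obj S lam Om') ->
  0 < d ->
  (forall h k l, 0 < h -> h < d ->
     `|Om k l + h * (eps * symdelta i j k l)|
       <= `|Om k l| + sg * symdelta i j k l * h) ->
  eps * invmx Om i j <= eps * S i j + lam * sg.
Proof.
move=> sS mu0 lam0 muOm Ommin d0 hd.
have sOm := loewner_lb_sym _ _ muOm.
have := @glasso_stationary _ _ S Om (eps *: symdelta i j) lam mu (sg * 2) d.
rewrite !mdotZr !mdot_symdelta ?trmx_inv ?sOm// => st.
have {}st : eps * (2 * invmx Om i j) <= eps * (2 * S i j) + lam * (sg * 2).
  apply: st => //; first by rewrite linearZ /= symdelta_sym.
  move=> h h0 hhd.
  have -> : sg * 2 * h = \sum_k \sum_l sg * symdelta i j k l * h.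
    under eq_bigr do rewrite -mulr_suml -mulr_sumr.
    rewrite -mulr_suml -mulr_sumr; congr (_ * _ * _).
    (* Pairing with the all-ones matrix shows that the entries of [symdelta i j] sum to 2. *)
    have := mdot_symdelta (const_mx 1 : 'M[R]_p) i j.
    rewrite trmx_const mxE mulr1 => /(_ erefl) <-.
    by do 2!apply: eq_bigr => ? _; rewrite mxE mul1r.
  rewrite -big_split; apply: ler_sum => k _ /=.
  rewrite -big_split; apply: ler_sum => l _ /=.
  by apply: le_trans (hd h k l h0 hhd); rewrite !mxE.
lra.
Qed.

(** Moves in both directions with [sg = 1], by the triangle inequality, give the two bounds. At a
    nonzero entry, the move towards zero has [sg = -1] and forces equality. *)
Lemma glasso_KKT {R : realType} {p} (S Om : 'M[R]_p) (lam mu : R) (i j : 'I_p) :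
  S^T = S -> 0 < mu -> 0 < lam -> loewner_le mu%:M Om ->
  (forall Om', posdef Om' -> glasso_obj S lam Om <= glasso_obj S lam Om') ->
  [/\ - lam <= invmx Om i j - S i j <= lam,
      0 < Om i j -> invmx Om i j - S i j = lam &
      Om i j < 0 -> invmx Om i j - S i j = - lam].
Proof.
move=> sS mu0 lam0 muOm Ommin; have sOm := loewner_lb_sym _ _ muOm.
have ent := @glasso_entry _ _ S Om lam mu _ _ _ i j sS mu0 lam0 muOm Ommin.
have E0 := @symdelta_ge0 R _ i j; have E2 := @symdelta_le2 R _ i j.
have Es k l := symdelta_supp Om i j k l sOm.
have triv (eps : R) : `|eps| = 1 -> eps * invmx Om i j <= eps * S i j + lam * 1.
  move=> e1; apply: (ent 1) => // h k l h0 _.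
  apply: le_trans (ler_normD _ _) _; rewrite lerD2l !normrM e1 (gtr0_norm h0) !mul1r.
  by rewrite ger0_norm// mulrC.
have bd : - lam <= invmx Om i j - S i j <= lam.
  have := triv 1 (normr1 _); have := triv (-1) (normrN1 _).
  by move=> h1 h2; apply/andP; split; lra.
split=> // [Op|Op].
  (* Entries of [symdelta] are at most 2, so steps below [Om i j / 2] preserve the sign. *)
  have := ent (Om i j / 2) (-1) (-1); case/andP: bd => _ up.
  have d0 : 0 < Om i j / 2 by lra.
  move=> /(_ d0) H; have {}H : -1 * invmx Om i j <= -1 * S i j + lam * -1.
    apply: H => h k l h0 hd; have [->|Okl] := Es k l; first by rewrite !mulr0 mul0r !addr0.
    have := ler_wpM2l (ltW h0) (E2 k l); have := mulr_ge0 (ltW h0) (E0 k l).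
    by move=> hE2 hE0; rewrite Okl !gtr0_norm; lra.
  lra.
have := ent (- Om i j / 2) 1 (-1); case/andP: bd => lo _.
have d0 : 0 < - Om i j / 2 by lra.
move=> /(_ d0) H; have {}H : 1 * invmx Om i j <= 1 * S i j + lam * -1.
  apply: H => h k l h0 hd; have [->|Okl] := Es k l; first by rewrite !mulr0 mul0r !addr0.
  have := ler_wpM2l (ltW h0) (E2 k l); have := mulr_ge0 (ltW h0) (E0 k l).
  by move=> hE2 hE0; rewrite Okl !ltr0_norm; lra.
lra.
Qed.

(** Where [Om i j] is nonzero, [y] sits at the clipping level of the same sign, so the added term
    overshoots and is clipped back; where it vanishes, [y] already lies in [[-lam, lam]]. *)
Lemma glasso_fixpoint {R : realType} {p} (S Om : 'M[R]_p) (lam mu zeta : R) :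
  S^T = S -> 0 < mu -> 0 < lam -> 0 < zeta -> loewner_le mu%:M Om ->
  (forall Om', posdef Om' -> glasso_obj S lam Om <= glasso_obj S lam Om') ->
  clip lam (invmx Om - S + zeta *: Om) + S = invmx Om.
Proof.
move=> sS mu0 lam0 zeta0 muOm Ommin; apply/matrixP => i j.
have [] := glasso_KKT S Om lam mu i j sS mu0 lam0 muOm Ommin.
set y := invmx Om i j - S i j => /andP[lo up] Op On.
suff clipy : Num.min (Num.max (y + zeta * Om i j) (- lam)) lam = y.
  by rewrite -[RHS](subrK (S i j)) -/y -{}clipy /y; move: (invmx Om) => G; rewrite !mxE.
have [O0|O0|->] := ltrgtP (Om i j) 0.
- have zO : zeta * Om i j < 0 by rewrite pmulr_rlt0.
  by rewrite (On O0) max_r ?min_l; lra.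
- have zO : 0 < zeta * Om i j by rewrite mulr_gt0.
  by rewrite (Op O0) max_l ?min_r; lra.
- by rewrite mulr0 addr0 max_l// min_l.
Qed.

(** * The error of one optimization iteration *)

Lemma clip_lipschitz {R : realType} {m n} (lam : R) (A B : 'M[R]_(m, n)) :
  0 < lam -> frob (clip lam A - clip lam B) <= frob (A - B).
Proof.
move=> lam0; rewrite !frobE ler_sqrt ?mdot_ge0//.
apply: ler_sum => i _; apply: ler_sum => j _; rewrite -!expr2 !mxE.
rewrite -[leLHS]real_normK ?num_real// -[leRHS]real_normK ?num_real//.
rewrite ler_sqr ?nnegrE//.
set x := A i j; set y := B i j.
have h1 : x - y <= `|x - y| by exact: ler_norm.
have h2 : y - x <= `|x - y| by rewrite distrC ler_norm.
move: h1 h2; rewrite ler_norml; set z := `|x - y| => h1 h2.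
by apply/andP; split; case: (ltrP x (- lam)) => ?; case: (ltrP y (- lam)) => ?;
  do 2?[case: (ltrP _ lam) => ?]; lra.
Qed.

(** The factor 2 arises because [S] enters both inside the clipping and after it. *)
Lemma upd_dist {R : realType} {p} (S Ss G H : 'M[R]_p) (lam zeta beta a b : R) :
  0 < a -> a <= b -> 0 < lam ->
  loewner_le a%:M G -> loewner_le G b%:M ->
  loewner_le a%:M H -> loewner_le H b%:M ->
  clip lam (H - Ss + zeta *: invmx H) + Ss = H ->
  `|1 - zeta / a ^+ 2| <= beta -> `|1 - zeta / b ^+ 2| <= beta ->
  frob (clip lam (G - S + zeta *: invmx G) + S - H)
    <= beta * frob (G - H) + 2 * frob (S - Ss).
Proof.
move=> a0 ab lam0 aG Gb aH Hb fixH ba bb.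
have b0 : 0 < b by exact: lt_le_trans ab.
have uG := posdef_unitmx _ (loewner_posdef _ _ a0 aG).
have uH := posdef_unitmx _ (loewner_posdef _ _ a0 aH).
rewrite -{1}fixH.
set X := G - S + _; set Y := H - Ss + _.
have -> : clip lam X + S - (clip lam Y + Ss) = (clip lam X - clip lam Y) + (S - Ss).
  by rewrite opprD addrACA.
apply: le_trans (ler_frobD _ _) _.
have : frob (X - Y) <= beta * frob (G - H) + frob (S - Ss).
  have -> : X - Y = ((G - H) - zeta *: (invmx G *m (G - H) *m invmx H)) + - (S - Ss).
    (* Resolvent identity [G^-1 (G - H) H^-1 = H^-1 - G^-1]. *)
    rewrite mulmxBr mulVmx// mulmxBl mul1mx -mulmxA mulmxV// mulmx1.
    rewrite /X /Y; apply/matrixP => k l; rewrite !mxE; ring.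
  apply: le_trans (ler_frobD _ _) _; rewrite frobN lerD2r.
  apply: (@sandwich_contraction _ _ b^-1 a^-1); rewrite ?invr_gt0 ?lef_pV2 ?exprVn//.
  - exact: loewner_invmx_lb aG Gb.
  - exact: loewner_invmx_ub.
  - exact: loewner_invmx_lb aH Hb.
  - exact: loewner_invmx_ub.
have := clip_lipschitz lam X Y lam0; lra.
Qed.

(** * Unrolling the recursion over iterations and time *)

(** Used twice: with factor [beta] over the iterations of one time step, then with factor
    [beta ^+ K] over time. *)
Lemma affine_recursion_le {R : realFieldType} (q : R) (x c : nat -> R) (m n : nat) :
  0 <= q -> (m <= n)%N ->
  (forall k, (m <= k < n)%N -> x k.+1 <= q * x k + c k.+1) ->
  x n <= q ^+ (n - m) * x m + \sum_(m.+1 <= l < n.+1) q ^+ (n - l) * c l.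
Proof.
move=> q0 /subnK <-; elim: (n - m)%N => [|d IH] rec.
  by rewrite add0n subnn mul1r big_geq ?addr0.
rewrite addSn; apply: le_trans (rec _ _) _; first by rewrite addSn leq_addl /=.
have {}IH := IH _; rewrite big_nat_recr /= ?ltnS ?leq_addl//.
rewrite subnn mul1r addrA lerD2r.
have -> : \sum_(m.+1 <= l < (d + m).+1) q ^+ ((d + m).+1 - l) * c l
    = q * \sum_(m.+1 <= l < (d + m).+1) q ^+ (d + m - l) * c l.
  rewrite mulr_sumr; apply: eq_big_nat => l /andP[_]; rewrite ltnS => ld.
  by rewrite subSn// exprS mulrA.
rewrite subSn ?leq_addl// exprS -mulrA -mulrDr ler_wpM2l//; apply: IH => k /andP[mk kd].
by apply: rec; rewrite mk addSn ltnW.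
Qed.

Lemma Gamma_GK {R : realType} {p n} (e : rel 'I_n) meas (X : nat -> 'cV[R]_p)
    W t0 K lam zeta i t :
  Gamma e meas X W t0 K lam zeta i t K = GK e meas X W t0 K lam zeta i t.
Proof. by rewrite /Gamma; case: t => [|t] //=; case: ifP. Qed.

Theorem theorem1 (R : realType) (p n : nat) (e : rel 'I_n)
  (meas : 'I_n -> 'I_p -> bool) (X : nat -> 'cV[R]_p) (Sstar : 'M[R]_p)
  (W t0 K : nat) (lam zeta a b : R) (OmStar : 'M[R]_p) (i : 'I_n) (t : nat) :
  (* graph: undirected, no self loops, connected *)
  symmetric e -> irreflexive e -> (forall u v : 'I_n, connect e u v) ->
  posdef Sstar ->
  (1 <= W)%N -> 0 < lam ->
  (* Omega* minimizes the graphical-lasso objective over positive definite matrices *)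
  posdef OmStar ->
  (forall Om : 'M[R]_p, posdef Om -> glasso_obj Sstar lam OmStar <= glasso_obj Sstar lam Om) ->
  0 < a -> a < b -> 0 < zeta ->
  (forall s k, (t0 <= s)%N -> (1 <= k <= K)%N ->
     loewner_le (a%:M) (Gamma e meas X W t0 K lam zeta i s k) /\
     loewner_le (Gamma e meas X W t0 K lam zeta i s k) (b%:M)) ->
  loewner_le (a%:M) (invmx OmStar) -> loewner_le (invmx OmStar) (b%:M) ->
  (t0 <= t)%N ->
  let beta := Num.max `|1 - zeta / a ^+ 2| `|1 - zeta / b ^+ 2| in
  let GStar := invmx OmStar in
  frob (Gamma e meas X W t0 K lam zeta i t K - GStar) <=
    beta ^+ (K * (t - t0)) * frob (Gamma e meas X W t0 K lam zeta i t0 K - GStar)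
    + 2 * \sum_(1 <= m < K.+1) (beta ^+ (K - m) *
          \sum_(t0.+1 <= l < t.+1) (beta ^+ (K * (t - l)) *
                frob (SW e meas X W l i - Sstar))).
Proof.
move=> _ _ _ [sS _] _ lam0 _ Ommin a0 ab zeta0 Gbd aH Hb t0t.
lazy zeta; set beta := Num.max _ _; set GStar := invmx OmStar.
have b0 : 0 < b by exact: lt_trans ab.
have ba : `|1 - zeta / a ^+ 2| <= beta by rewrite le_max lexx.
have bb : `|1 - zeta / b ^+ 2| <= beta by rewrite le_max lexx orbT.
have beta0 : 0 <= beta by exact: le_trans ba.
(* The upper bound on [Gamma*] supplies the uniform lower bound on [Omega*] that the perturbation
   argument requires. *)
have bOm : loewner_le (b^-1)%:M OmStar.
  by rewrite -[OmStar]invmxK; exact: loewner_invmx_lb aH Hb.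
have fixH : clip lam (GStar - Sstar + zeta *: invmx GStar) + Sstar = GStar.
  by rewrite invmxK; apply: glasso_fixpoint bOm Ommin; rewrite ?invr_gt0.
pose G := GK e meas X W t0 K lam zeta i.
pose sig l := frob (SW e meas X W l i - Sstar).
pose A : R := \sum_(1 <= m < K.+1) beta ^+ (K - m).
have step s : (t0 <= s < t)%N ->
    frob (G s.+1 - GStar) <= beta ^+ K * frob (G s - GStar) + 2 * A * sig s.+1.
  move=> /andP[t0s _]; pose y k := frob (iter k (upd e meas X W lam zeta i s.+1) (G s) - GStar).
  have -> : G s.+1 = iter K (upd e meas X W lam zeta i s.+1) (G s).
    by rewrite /G /= ltnNge t0s.
  have := affine_recursion_le beta y (fun=> 2 * sig s.+1) 0 K beta0 (leq0n K).
  rewrite subn0 -mulr_suml -/A mulrA [A * 2]mulrC; apply=> k /= kK.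
  have [aG Gb] : loewner_le a%:M (iter k (upd e meas X W lam zeta i s.+1) (G s)) /\
      loewner_le (iter k (upd e meas X W lam zeta i s.+1) (G s)) b%:M.
    (* Iterate 0 at time [s.+1] is iterate [K] at time [s]; its bounds are the assumed ones at index
       [K], which is positive because [0 < K] here. *)
    case: k kK => [K0|k kK] /=.
      by rewrite /G -Gamma_GK; apply: Gbd => //; rewrite K0 leqnn.
    by have := Gbd s.+1 k.+1 (leqW t0s) (ltnW kK); rewrite /Gamma ltnNge t0s.
  exact: (upd_dist _ _ _ _ _ _ _ _ _ a0 (ltW ab) lam0 aG Gb aH Hb fixH ba bb).
(* The sum over [l] does not depend on [m], so the double sum factors through [A]. *)
rewrite !Gamma_GK -/G -mulr_suml -/A mulrA.
have := affine_recursion_le (beta ^+ K) (fun s => frob (G s - GStar))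
  (fun s => 2 * A * sig s) t0 t (exprn_ge0 K beta0) t0t step.
rewrite -exprM; congr (_ <= _ + _); rewrite mulr_sumr; apply: eq_bigr => l _.
by rewrite exprM mulrCA.
Qed.
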